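(* Let $\mathsf{JL}$ be one of the justification logics described in the context, and let $\mathcal{CS}$ be a constant specification for $\mathsf{JL}$. In any $\mathsf{JL}^e_{\mathcal{CS}}$-tableau proof: every $\mathsf{JL}$-formula in the tableau is a weak $\mathcal{CS}$-subformula of the root of the tableau; for every evidential formula $[t,A]$ or $\sim[t,A]$ in the tableau, the $\mathsf{JL}$-formula $A$ is a $\mathcal{CS}$-subformula of the root, and the term $t$ occurs in the root or in a formula in $\mathcal{CS}$.
   Context: **Language.** Justification terms are built from justification variables $x,y,z,\dots$ and justification constants $a,b,c,\dots$ using binary operations $\cdot$, $+$ and unary operations $!$, $\bar{?}$, $?$. Formulas are given by $A ::= p \mid \bot \mid \neg A \mid A\to A \mid t:A$, where $p$ ranges over a countable set $\mathcal{P}$ of propositional variables and $t$ over terms. Subterms are defined as usual. A term $t$ occurs in a formula $F$ if $t$ is a subterm of some $r$ such that $r:B$ is a subformula of $F$ for some $B$. $Sub(A)$ is the set of subformulas: $Sub(p)=\{p\}$, $Sub(\bot)=\{\bot\}$, $Sub(\neg A)=\{\neg A\}\cup Sub(A)$, $Sub(A\to B)=\{A\to B\}\cup Sub(A)\cup Sub(B)$, $Sub(t:A)=\{t:A\}\cup Sub(A)$; for a set $S$ of formulas, $Sub(S)=\bigcup_{A\in S}Sub(A)$. **Justification logics.** The basic logic $\mathsf{J}$ has axiom schemes: (Taut) all propositional tautologies; (Sum) $s:A\to(s+t):A$ and $s:A\to(t+s):A$; (jK) $s:(A\to B)\to(t:A\to(s\cdot t):B)$. $\mathsf{JL}$ denotes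 any logic obtained from $\mathsf{J}$ by adding any combination (possibly none) of: (jT) $t:A\to A$; (jD) $t:\bot\to\bot$; (j4) $t:A\to\,!t:t:A$; (jB) $\neg A\to\bar{?}t:\neg t:A$; (j5) $\neg t:A\to\,?t:\neg t:A$. The language of $\mathsf{JL}$ includes only those term operations present in its axioms; its formulas are called $\mathsf{JL}$-formulas. **Constant specification.** A constant specification $\mathcal{CS}$ for $\mathsf{JL}$ is a set of formulas $c_{i_n}:c_{i_{n-1}}:\dots:c_{i_1}:A$, with $n\ge1$, the $c_{i_j}$ justification constants and $A$ an axiom instance of $\mathsf{JL}$, which is downward closed: if $c_{i_n}:c_{i_{n-1}}:\dots:c_{i_1}:A\in\mathcal{CS}$ with $n\ge2$, then $c_{i_{n-1}}:\dots:c_{i_1}:A\in\mathcal{CS}$. **$\mathcal{CS}$-subformulas.** $A$ is a $\mathcal{CS}$-subformula of $B$ if $A\in Sub(\{B\}\cup\mathcal{CS})$. $A$ is a weak $\mathcal{CS}$-subformula of $B$ if $A\in Sub(\{B\}\cup\mathcal{CS})$ or $A=\neg C$ for some $C\in Sub(\{B\}\cup\mathcal{CS})$. **Tableaux.** Tableaux use $\mathsf{JL}$-formulas and evidential formulas $[t,A]$ and $\sim[t,A]$, where $t$ is a term and $A$ a $\mathsf{JL}$-formula. A $\mathsf{JL}^e_{\mathcal{CS}}$-tableau for a formula $F$ is a binary tree with root $\neg F$ built by extending branches with the following rules (premises must be on the branch; ''$\mid$'' means the branch splits): - $(F\neg)$: from $\neg\neg A$ add $A$. $(F\to)$: from $\neg(A\to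 B)$ add $A$ and $\neg B$. $(T\to)$: from $A\to B$ split $\neg A\mid B$. - $(Te)$: from $t:A$ add $[t,A]$. $(Fe)$: from $\neg t:A$ add $\sim[t,A]$. - $(+_L)$: from $\sim[t+s,A]$ add $\sim[t,A]$. $(+_R)$: from $\sim[t+s,A]$ add $\sim[s,A]$. - $(\cdot)$: from $[s,A\to B]$ and $[t,A]$ add $[s\cdot t,B]$, provided $A\to B$ is a $\mathcal{CS}$-subformula of the root and $s\cdot t$ occurs in the root. - $(PB)$: split $A\mid\neg A$, provided $A$ is a $\mathcal{CS}$-subformula of the root. - $(PB_e)$: split $[t,A]\mid\sim[t,A]$, provided $A$ is a $\mathcal{CS}$-subformula of the root and $t$ occurs in the root. - If $\mathsf{JL}$ contains jT, $(e)$: from $[t,A]$ add $A$. If jD, $(e_\bot)$: from $[t,\bot]$ add $\bot$. If j4, $(!)$: from $\sim[!t,t:A]$ add $\sim[t,A]$. If jB, $(\bar{?})$: from $\sim[\bar{?}t,\neg t:A]$ add $A$. If j5, $(?)$: from $\sim[?t,\neg t:A]$ add $[t,A]$. A branch closes if it contains $A$ and $\neg A$ for some $\mathsf{JL}$-formula $A$; or $[t,A]$ and $\sim[t,A]$ for some $t,A$; or $\bot$; or $\neg c:F$ for some $c:F\in\mathcal{CS}$. A tableau closes if all its branches close. A $\mathsf{JL}^e_{\mathcal{CS}}$-tableau proof of $F$ is a closed $\mathsf{JL}^e_{\mathcal{CS}}$-tableau with root $\neg F$. *)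

(* Defs.v *)
From mathcomp Require Import all_boot.
From mathcomp Require Import boolp classical_sets.

Set Implicit Arguments.
Unset Strict Implicit.
Unset Printing Implicit Defensive.

Local Open Scope classical_set_scope.

(* The schemes added to J; each of the 32 values is one logic JL. *)
Record logic := Logic { jT : bool; jD : bool; j4 : bool; jB : bool; j5 : bool }.

(* The operations !, ?-bar and ? carry evidence that the corresponding scheme
   belongs to L, so that [term L] and [form L] are exactly the terms and
   formulas of the language of L. *)
Inductive term (L : logic) : Type :=
  | TVar of nat
  | TConst of nat
  | TApp of term L & term L
  | TSum of term L & term L
  | TBang of j4 L & term L
  | TBarQ of jB L & term L
  | TQ of j5 L & term L.
Arguments TVar {L} _.
Arguments TConst {L} _.

Inductive form (L : logic) : Type :=
  | PVar of nat
  | Bot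
  | Neg of form L
  | Imp of form L & form L
  | Just of term L & form L.
Arguments PVar {L} _.
Arguments Bot {L}.

Section Syntax.
Variable L : logic.
Implicit Types (s t r : term L) (A B F : form L) (S CS : set (form L)).

Fixpoint subterms t : set (term L) :=
  match t with
  | TVar _ | TConst _ => [set t]
  | TApp t1 t2 | TSum t1 t2 => t |` (subterms t1 `|` subterms t2)
  | TBang _ t1 | TBarQ _ t1 | TQ _ t1 => t |` subterms t1
  end.

Fixpoint Sub A : set (form L) :=
  match A with
  | PVar _ | Bot => [set A]
  | Neg B => A |` Sub B
  | Imp B C => A |` (Sub B `|` Sub C)
  | Just _ B => A |` Sub B
  end.

Definition SubS S : set (form L) := \bigcup_(A in S) Sub A.

Definition occurs t F : Prop :=
  exists r B, Sub F (Just r B) /\ subterms r t.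

(* Truth under a propositional valuation: propositional variables and formulas
   t:A are the atoms, and only the values of v on these are used. *)
Fixpoint prop_eval (v : form L -> bool) A : bool :=
  match A with
  | PVar _ | Just _ _ => v A
  | Bot => false
  | Neg B => ~~ prop_eval v B
  | Imp B C => prop_eval v B ==> prop_eval v C
  end.

Definition tautology A : Prop := forall v, prop_eval v A.

Inductive axiom : form L -> Prop :=
  | ax_Taut A : tautology A -> axiom A
  | ax_SumL s t A : axiom (Imp (Just s A) (Just (TSum s t) A))
  | ax_SumR s t A : axiom (Imp (Just s A) (Just (TSum t s) A))
  | ax_jK s t A B :
      axiom (Imp (Just s (Imp A B)) (Imp (Just t A) (Just (TApp s t) B)))
  | ax_jT t A : jT L -> axiom (Imp (Just t A) A)
  | ax_jD t : jD L -> axiom (Imp (Just t Bot) Bot)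
  | ax_j4 (h : j4 L) t A :
      axiom (Imp (Just t A) (Just (TBang h t) (Just t A)))
  | ax_jB (h : jB L) t A :
      axiom (Imp (Neg A) (Just (TBarQ h t) (Neg (Just t A))))
  | ax_j5 (h : j5 L) t A :
      axiom (Imp (Neg (Just t A)) (Just (TQ h t) (Neg (Just t A)))).

(* const_chain [:: c_n; ...; c_1] A is c_n:...:c_1:A. *)
Definition const_chain (cs : seq nat) A : form L :=
  foldr (fun c B => Just (TConst c) B) A cs.

Definition constant_specification CS : Prop :=
  (forall F, CS F -> exists c cs A, axiom A /\ F = const_chain (c :: cs) A) /\
  (forall c d cs A, axiom A ->
     CS (const_chain (c :: d :: cs) A) -> CS (const_chain (d :: cs) A)).

Definition CS_subformula CS A B : Prop := SubS (B |` CS) A.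

Definition weak_CS_subformula CS A B : Prop :=
  SubS (B |` CS) A \/ exists C, SubS (B |` CS) C /\ A = Neg C.

(* EvT t A is [t,A] and EvF t A is ~[t,A]. *)
Inductive entry : Type :=
  | Fm of form L
  | EvT of term L & form L
  | EvF of term L & form L.

Inductive tree : Type :=
  | Leaf of entry
  | Unary of entry & tree
  | Binary of entry & tree & tree.

Fixpoint labels (T : tree) : set entry :=
  match T with
  | Leaf X => [set X]
  | Unary X T1 => X |` labels T1
  | Binary X T1 T2 => X |` (labels T1 `|` labels T2)
  end.

(* Rules and closure conditions only depend on which entries are on a branch,
   so a branch is represented by its set of entries. *)
Fixpoint branches (T : tree) : set (set entry) :=
  match T with
  | Leaf X => [set [set X]]
  | Unary X T1 => [set X |` b | b in branches T1]
  | Binary X T1 T2 => [set X |` b | b in branches T1 `|` branches T2]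
  end.

Section Tableaux.
Variables (CS : set (form L)) (root : form L).

(* linear_rule b Xs: the entries Xs may be appended, in this order, to b. *)
Inductive linear_rule (b : set entry) : seq entry -> Prop :=
  | rule_FNeg A : b (Fm (Neg (Neg A))) -> linear_rule b [:: Fm A]
  | rule_FImp A B :
      b (Fm (Neg (Imp A B))) -> linear_rule b [:: Fm A; Fm (Neg B)]
  | rule_Te t A : b (Fm (Just t A)) -> linear_rule b [:: EvT t A]
  | rule_Fe t A : b (Fm (Neg (Just t A))) -> linear_rule b [:: EvF t A]
  | rule_SumL t s A : b (EvF (TSum t s) A) -> linear_rule b [:: EvF t A]
  | rule_SumR t s A : b (EvF (TSum t s) A) -> linear_rule b [:: EvF s A]
  | rule_App s t A B :
      b (EvT s (Imp A B)) -> b (EvT t A) ->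
      CS_subformula CS (Imp A B) root -> occurs (TApp s t) root ->
      linear_rule b [:: EvT (TApp s t) B]
  | rule_e t A : jT L -> b (EvT t A) -> linear_rule b [:: Fm A]
  | rule_eBot t : jD L -> b (EvT t Bot) -> linear_rule b [:: Fm Bot]
  | rule_Bang (h : j4 L) t A :
      b (EvF (TBang h t) (Just t A)) -> linear_rule b [:: EvF t A]
  | rule_BarQ (h : jB L) t A :
      b (EvF (TBarQ h t) (Neg (Just t A))) -> linear_rule b [:: Fm A]
  | rule_Q (h : j5 L) t A :
      b (EvF (TQ h t) (Neg (Just t A))) -> linear_rule b [:: EvT t A].

Inductive split_rule (b : set entry) : entry -> entry -> Prop :=
  | rule_TImp A B : b (Fm (Imp A B)) -> split_rule b (Fm (Neg A)) (Fm B)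
  | rule_PB A : CS_subformula CS A root -> split_rule b (Fm A) (Fm (Neg A))
  | rule_PBe t A :
      CS_subformula CS A root -> occurs t root ->
      split_rule b (EvT t A) (EvF t A).

Fixpoint chain (X : entry) (Xs : seq entry) : tree :=
  match Xs with
  | [::] => Leaf X
  | Y :: Ys => Unary X (chain Y Ys)
  end.

(* grows b T T': T' arises from T by one rule application at a leaf of T,
   where b is the set of entries on the path leading to (and above) T. *)
Inductive grows : set entry -> tree -> tree -> Prop :=
  | grows_linear b X Xs :
      linear_rule (X |` b) Xs -> grows b (Leaf X) (chain X Xs)
  | grows_split b X Y Z :
      split_rule (X |` b) Y Z ->
      grows b (Leaf X) (Binary X (Leaf Y) (Leaf Z))
  | grows_unary b X T T' :
      grows (X |` b) T T' -> grows b (Unary X T) (Unary X T')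
  | grows_left b X T1 T1' T2 :
      grows (X |` b) T1 T1' -> grows b (Binary X T1 T2) (Binary X T1' T2)
  | grows_right b X T1 T2 T2' :
      grows (X |` b) T2 T2' -> grows b (Binary X T1 T2) (Binary X T1 T2').

Inductive tableau_from : tree -> Prop :=
  | tableau_root : tableau_from (Leaf (Fm root))
  | tableau_step T T' : tableau_from T -> grows set0 T T' -> tableau_from T'.

End Tableaux.

Definition tableau CS F (T : tree) : Prop := tableau_from CS (Neg F) T.

Inductive closed_branch CS (b : set entry) : Prop :=
  | closed_Fm A : b (Fm A) -> b (Fm (Neg A)) -> closed_branch CS b
  | closed_Ev t A : b (EvT t A) -> b (EvF t A) -> closed_branch CS b
  | closed_Bot : b (Fm Bot) -> closed_branch CS b
  | closed_CS c F :
      CS (Just (TConst c) F) -> b (Fm (Neg (Just (TConst c) F))) ->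
      closed_branch CS b.

Definition closed_tableau CS (T : tree) : Prop :=
  forall b, branches T b -> closed_branch CS b.

Definition tableau_proof CS F (T : tree) : Prop :=
  tableau CS F T /\ closed_tableau CS T.

End Syntax.

(* Main.v *)
(** Every tableau rule preserves the property that the entries of a branch are
    as described in the theorem. The rules only take formulas apart, so they
    stay within the CS-subformulas; the negations they add cannot pile up,
    because if [Neg A] is a weak CS-subformula then [A] is a CS-subformula. *)

Require Import Defs.
From mathcomp Require Import all_boot.
From mathcomp Require Import boolp classical_sets.

Set Implicit Arguments.
Unset Strict Implicit.
Unset Printing Implicit Defensive.

Local Open Scope classical_set_scope.

Section Subterms.
Variable L : logic.
Implicit Types (s t r : term L) (A B C : form L).

Lemma subterms_refl t : subterms t t.
Proof. by case: t => *; [| |left..]. Qed.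

Lemma subterms_trans s t r : subterms s t -> subterms t r -> subterms s r.
Proof.
elim: s => [n|n|s1 IH1 s2 IH2|s1 IH1 s2 IH2|h s1 IH|h s1 IH|h s1 IH] /=.
1,2: by move=> ->.
1,2: by case=> [->//|[/IH1|/IH2] tr /tr ?]; right; [left|right].
all: by case=> [->//|/IH tr /tr ?]; right.
Qed.

Lemma Sub_refl A : Defs.Sub A A.
Proof. by case: A => *; [| |left..]. Qed.

Lemma Sub_trans A B C : Defs.Sub A B -> Defs.Sub B C -> Defs.Sub A C.
Proof.
elim: A => [n||A IH|A1 IH1 A2 IH2|t A IH] /=.
1,2: by move=> ->.
2: by case=> [->//|[/IH1|/IH2] tr /tr ?]; right; [left|right].
all: by case=> [->//|/IH tr /tr ?]; right.
Qed.

End Subterms.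

Section SubformulaProperty.
Variables (L : logic) (CS : set (form L)) (root : form L).
Implicit Types (s t r : term L) (A B : form L) (X : entry L).

Let csub A := CS_subformula CS A root.
Let wsub A := weak_CS_subformula CS A root.

Definition CS_occurs t : Prop :=
  occurs t root \/ exists G, CS G /\ occurs t G.

Lemma CS_subformula_trans A B : csub A -> Defs.Sub A B -> csub B.
Proof. by move=> [C ? CA] AB; exists C => //; exact: Sub_trans CA AB. Qed.

Lemma CS_subformula_Neg A : csub (Neg A) -> csub A.
Proof. by move/CS_subformula_trans; apply; right; exact: Sub_refl. Qed.

Lemma CS_subformula_ImpL A B : csub (Imp A B) -> csub A.
Proof. by move/CS_subformula_trans; apply; right; left; exact: Sub_refl. Qed.

Lemma CS_subformula_ImpR A B : csub (Imp A B) -> csub B.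
Proof. by move/CS_subformula_trans; apply; right; right; exact: Sub_refl. Qed.

Lemma CS_subformula_Just t A : csub (Just t A) -> csub A.
Proof. by move/CS_subformula_trans; apply; right; exact: Sub_refl. Qed.

(** Either [Neg A] is itself a CS-subformula, or it equals [Neg C] with [C] one, and injectivity of
    [Neg] gives [A = C]. Hence a negated premise always yields a strict CS-subformula. *)
Lemma weak_CS_subformula_Neg A : wsub (Neg A) -> csub A.
Proof. by case=> [/CS_subformula_Neg//|[C [SC [->]]]]. Qed.

(** The root or the member of [CS] that contains [Just t A] also witnesses the occurrence of [t]. *)
Lemma CS_subformula_occurs t A : csub (Just t A) -> CS_occurs t.
Proof.
move=> [G [->|CSG] GA]; [left|right; exists G; split=> //].
all: by exists t, A; split=> //; exact: subterms_refl.
Qed.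

(** Serves the sum rules, which replace a sum by a summand. *)
Lemma CS_occurs_subterm s t : CS_occurs s -> subterms s t -> CS_occurs t.
Proof.
move=> [[r [B [rB rs]]]|[G [CSG [r [B [rB rs]]]]]] st.
  by left; exists r, B; split=> //; exact: subterms_trans rs st.
right; exists G; split=> //; exists r, B; split=> //.
exact: subterms_trans rs st.
Qed.

(** The invariant. Formula entries are only weak, since some rules add a negation; evidential
    entries stay strict. *)
Definition analytic X : Prop :=
  match X with
  | Fm A => wsub A
  | EvT t A | EvF t A => csub A /\ CS_occurs t
  end.

(** The fold is the conjunction of [analytic] over the appended entries; it reduces to explicit
    conjuncts for each rule. *)
Lemma linear_rule_analytic (b : set (entry L)) Xs :
  linear_rule CS root b Xs -> (forall X, b X -> analytic X) ->
  foldr (fun X P => analytic X /\ P) True Xs.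
Proof.
move=> rule bP; case: rule => /=.
- move=> A /bP /weak_CS_subformula_Neg /CS_subformula_Neg sA.
  by split=> //; left.
- move=> A B /bP /weak_CS_subformula_Neg sAB; split.
    by left; exact: CS_subformula_ImpL sAB.
  by split=> //; right; exists B; split=> //; exact: CS_subformula_ImpR sAB.
(* A formula [t:A] is not a negation, so only the strict alternative remains. *)
- move=> t A /bP [stA|[C [_ //]]]; do 2!split=> //.
    exact: CS_subformula_Just stA.
  exact: CS_subformula_occurs stA.
- move=> t A /bP /weak_CS_subformula_Neg stA; do 2!split=> //.
    exact: CS_subformula_Just stA.
  exact: CS_subformula_occurs stA.
- move=> t s A /bP [sA ots]; do 2!split=> //.
  by apply: CS_occurs_subterm ots _; right; left; exact: subterms_refl.
- move=> t s A /bP [sA ots]; do 2!split=> //.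
  by apply: CS_occurs_subterm ots _; right; right; exact: subterms_refl.
(* Both claims come from the side conditions of the rule: [B] lies in [Imp A B], and the product
   occurs in the root. *)
- move=> s t A B _ _ sAB ost; do 2!split=> //; last by left.
  exact: CS_subformula_ImpR sAB.
- by move=> t A _ /bP [sA _]; split=> //; left.
- by move=> t _ /bP [sBot _]; split=> //; left.
(* The occurrence of [t] is read off the formula [Just t A] of the premise. *)
- move=> h t A /bP [stA _]; do 2!split=> //.
    exact: CS_subformula_Just stA.
  exact: CS_subformula_occurs stA.
- move=> h t A /bP [/CS_subformula_Neg stA _]; split=> //; left.
  exact: CS_subformula_Just stA.
- move=> h t A /bP [/CS_subformula_Neg stA _]; do 2!split=> //.
    exact: CS_subformula_Just stA.
  exact: CS_subformula_occurs stA.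
Qed.

Lemma split_rule_analytic (b : set (entry L)) Y Z :
  split_rule CS root b Y Z -> (forall X, b X -> analytic X) ->
  analytic Y /\ analytic Z.
Proof.
move=> rule bP; case: rule => /=.
- move=> A B /bP [sAB|[C [_ //]]]; split.
    by right; exists A; split=> //; exact: CS_subformula_ImpL sAB.
  by left; exact: CS_subformula_ImpR sAB.
- by move=> A sA; split; [left|right; exists A].
- by move=> t A sA ot; do 2!split=> //; left.
Qed.

Lemma chain_analytic X Xs :
  analytic X -> foldr (fun Y P => analytic Y /\ P) True Xs ->
  forall Y, labels (chain X Xs) Y -> analytic Y.
Proof.
elim: Xs X => [|Z Xs IH] X aX /=; first by move=> _ Y ->.
by move=> [aZ aXs] Y [->//|]; exact: IH.
Qed.

(** Rule premises may lie anywhere on the branch, so the induction carries the analyticity of the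
    set [b] of entries above the subtree along with that of its labels. *)
Lemma grows_analytic (b : set (entry L)) T T' :
  grows CS root b T T' -> (forall X, b X -> analytic X) ->
  (forall X, labels T X -> analytic X) ->
  forall X, labels T' X -> analytic X.
Proof.
(* Descending below a node adds its label to the path. *)
have cons (c : set (entry L)) X : analytic X -> (forall Y, c Y -> analytic Y) ->
    forall Y, (X |` c) Y -> analytic Y.
  by move=> aX cP Y [->//|/cP].
elim=> {b T T'} [b X Xs rule|b X Y Z rule|b X T T' _ IH|b X T1 T1' T2 _ IH
  |b X T1 T2 T2' _ IH] bP TP.
- have aX : analytic X by apply: TP.
  by apply: chain_analytic => //; apply: linear_rule_analytic rule _; exact: cons.
- have aX : analytic X by apply: TP.
  have [aY aZ] := split_rule_analytic rule (cons _ _ aX bP).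
  by move=> W [->//|[->|->]].
- have aX : analytic X by apply: TP; left.
  move=> W [->//|]; apply: IH; first exact: cons.
  by move=> V TV; apply: TP; right.
- have aX : analytic X by apply: TP; left.
  move=> W [->//|[|T2W]]; last by apply: TP; right; right.
  by apply: IH; [exact: cons|move=> V TV; apply: TP; right; left].
- have aX : analytic X by apply: TP; left.
  move=> W [->//|[T1W|]]; first by apply: TP; right; left.
  by apply: IH; [exact: cons|move=> V TV; apply: TP; right; right].
Qed.

(** The root is a subformula of itself, and each step grows the whole tree from the empty path,
    where the condition on [b] is vacuous. *)
Lemma tableau_from_analytic T :
  tableau_from CS root T -> forall X, labels T X -> analytic X.
Proof.
elim=> {T} [X ->|T T' _ IH step]; last exact: grows_analytic step _ IH.
by left; exists root; [left|exact: Sub_refl].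
Qed.

End SubformulaProperty.

Theorem theorem3p5 (L : logic) (CS : set (form L))
    (hCS : constant_specification CS) (F : form L) (T : tree L)
    (hT : tableau_proof CS F T) :
  (forall A : form L, labels T (Fm A) -> weak_CS_subformula CS A (Neg F)) /\
  (forall (t : term L) (A : form L),
     labels T (EvT t A) \/ labels T (EvF t A) ->
     CS_subformula CS A (Neg F) /\
     (occurs t (Neg F) \/ exists G : form L, CS G /\ occurs t G)).
Proof.
have [/tableau_from_analytic analyticT _] := hT.
by split=> [A /analyticT //|t A [] /analyticT].
Qed.
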